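(* Let $U$ be a nonempty finite set. (i) Let $\mathcal{B}_0$ be a Boolean sublattice of $\mathrm{Part}(U)$ containing $\triangle$ and $\nabla$ whose hypergraph $\mathcal{H}_0=\mathcal{H}(A(\mathcal{B}_0))$ is a hypertree. Then there exists a semi-interval system $\mathcal{I}\subseteq\wp(U)$ such that $\mathcal{D}(U,\mathcal{I})$ is maximal (with respect to inclusion) among the Boolean sublattices $\mathcal{B}$ of $\mathrm{Part}(U)$ containing $\triangle$ with the property $\mathcal{H}(A(\mathcal{B}))=\mathcal{H}_0$. (ii) Let $\mathcal{I}$ be a semi-interval system on $U$ such that $\mathcal{D}(U,\mathcal{I})$ is an atomistic lattice, and let $\mathcal{A}$ be the set of atoms of $\mathcal{D}(U,\mathcal{I})$. Then $\mathcal{D}(U,\mathcal{I})$ is a Boolean sublattice of $\mathrm{Part}(U)$ if and only if $\mathcal{H}(\mathcal{A})$ is a hypertree on $U$.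
   Context: $\mathrm{Part}(U)$ is the lattice of all partitions of $U$ ordered by refinement; $\triangle$ is its least element (all blocks singletons) and $\nabla$ its greatest element (single block $U$). A Boolean sublattice is a sublattice (closed under meet and join of $\mathrm{Part}(U)$) that is itself a Boolean lattice. $A(\mathcal{B})$ is the set of atoms of $\mathcal{B}$. A lattice with least element is atomistic if every element is a join of atoms. A closure system $(U,\mathcal{Q})$ is a family $\mathcal{Q}\subseteq\wp(U)$ containing $U$ and closed under arbitrary intersections. A semi-interval system is a closure system $(U,\mathcal{I})$ satisfying: (I$_0$) $\emptyset\in\mathcal{I}$ and $\{x\}\in\mathcal{I}$ for all $x\in U$; (I$_1$) if $A,B\in\mathcal{I}$ and $A\cap B\neq\emptyset$, then $A\cup B\in\mathcal{I}$. $\mathcal{D}(U,\mathcal{I})$ is the set of all partitions of $U$ all of whose blocks belong to $\mathcal{I}$, ordered by refinement; it is a lattice with least element $\triangle$, and its meet is the meet of $\mathrm{Part}(U)$. For a set $D\subseteq \mathrm{Part}(U)\setminus\{\triangle\}$ of partitions with pairwise meet $\triangle$, $\mathcal{H}(D)$ is the hypergraph with vertex set $U$ whose edges are the non-singleton blocks of all partitions in $D$. A path is a sequence $v_0,B_1,v_1,\dots,B_n,v_n$ with $v_{i-1},v_i\in B_i$, no vertices or edges repeated, except that possibly $v_0=v_n$; a cycle is a sequence $v_1,B_1,v_2,B_2,\dots,v_n,B_n,v_1$ with $n\ge 3$, $v_1\in B_1\cap B_n$, $v_i\in B_{i-1}\cap B_i$ for $2\le i\le n$, with $v_1,\dots,v_n$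 distinct vertices and $B_1,\dots,B_n$ distinct edges. A hypergraph is connected if any two distinct vertices are connected by a path. A hypertree is a connected hypergraph without cycles. *)

(* Defs.v *)
From HB Require Import structures.
From mathcomp Require Import all_boot all_order.

Set Implicit Arguments.
Unset Strict Implicit.
Unset Printing Implicit Defensive.

Import Order.TTheory.

Record part (U : finType) := Part {
  blocks :> {set {set U}};
  partP : partition blocks [set: U] }.

HB.instance Definition _ (U : finType) := [isSub for @blocks U].
HB.instance Definition _ (U : finType) := [Finite of part U by <:].

Fact part_display : Order.disp_t. Proof. exact: (Order.Disp tt tt). Qed.

Section PartLattice.
Variable U : finType.
Implicit Types (P Q S : part U) (x y z : U) (R : rel U).

Definition refines P Q := [forall A in blocks P, exists B in blocks Q, A \subset B].

Definition same_block P : rel U := fun x y => y \in pblock (blocks P) x.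

Lemma same_block_equiv P : equivalence_rel (same_block P).
Proof.
have /and3P[/eqP covP tiP _] := partP P.
move=> x y z; rewrite /same_block; split; first by rewrite mem_pblock covP inE.
by move/(same_pblock tiP) => ->.
Qed.

Fact part_of_subproof R (eqR : equivalence_rel R) :
  partition (equivalence_partition R [set: U]) [set: U].
Proof. by apply: equivalence_partitionP => x y z _ _ _; apply: eqR. Qed.

Definition part_of R (eqR : equivalence_rel R) : part U := Part (part_of_subproof eqR).

Lemma same_block_part_of R (eqR : equivalence_rel R) x y :
  same_block (part_of eqR) x y = R x y.
Proof.
by rewrite /same_block /= pblock_equivalence_partition ?inE //.
Qed.

Lemma part_ext P Q : same_block P =2 same_block Q -> P = Q.
Proof.
move=> eqPQ; apply: val_inj => /=.
rewrite -(equivalence_partition_pblock (partP P)).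
rewrite -(equivalence_partition_pblock (partP Q)).
apply: eq_imset => x; apply/setP => y; rewrite !inE /=; exact: eqPQ.
Qed.

Lemma refinesP P Q :
  reflect (forall x y, same_block P x y -> same_block Q x y) (refines P Q).
Proof.
have covE S x : x \in cover (blocks S) by rewrite (cover_partition (partP S)) inE.
have [_ tiP nP] := and3P (partP P); have [_ tiQ _] := and3P (partP Q).
apply: (iffP forall_inP) => [ref x y xy | sub A AP].
  have /exists_inP[B BQ sAB] := ref _ (pblock_mem (covE P x)).
  have xB : x \in B by rewrite (subsetP sAB) // mem_pblock covE.
  rewrite /same_block (def_pblock tiQ BQ xB); exact: (subsetP sAB).
have /set0Pn[x xA] : A != set0 by apply: contraNneq nP => <-.
apply/exists_inP; exists (pblock (blocks Q) x); first exact: pblock_mem.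
apply/subsetP => y yA; apply: sub.
by rewrite /same_block (def_pblock tiP AP xA).
Qed.

Fact refines_refl : reflexive refines.
Proof. by move=> P; apply/refinesP. Qed.

Fact refines_anti : antisymmetric refines.
Proof.
move=> P Q /andP[/refinesP PQ /refinesP QP]; apply: part_ext => x y.
by apply/idP/idP; [apply: PQ | apply: QP].
Qed.

Fact refines_trans : transitive refines.
Proof.
move=> Q P S /refinesP PQ /refinesP QS; apply/refinesP => x y xy.
exact/QS/PQ.
Qed.

Fact meet_equiv P Q :
  equivalence_rel (fun x y => same_block P x y && same_block Q x y).
Proof.
move=> x y z.
have [Pxx PE] := same_block_equiv P x y z; have [Qxx QE] := same_block_equiv Q x y z.
split; first by rewrite Pxx Qxx.
by case/andP => /PE -> /QE ->.
Qed.

Definition part_meet P Q := part_of (meet_equiv P Q).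

Definition join_step P Q : rel U := fun x y => same_block P x y || same_block Q x y.

Fact join_equiv P Q : equivalence_rel (connect (join_step P Q)).
Proof.
have sbC S : symmetric (same_block S).
  move=> x y; apply/idP/idP => xy.
    have [_ /(_ xy) <-] := same_block_equiv S x y x.
    by have [-> _] := same_block_equiv S x x x.
  have [_ /(_ xy) <-] := same_block_equiv S y x y.
  by have [-> _] := same_block_equiv S y y y.
have symC : connect_sym (join_step P Q).
  by apply: sym_connect_sym => x y; rewrite /join_step !(sbC _ x y).
move=> x y z; split; first exact: connect0.
by move=> xy; apply: (same_connect symC).
Qed.

Definition part_join P Q := part_of (join_equiv P Q).

Fact eq_equiv : equivalence_rel (fun x y : U => x == y).
Proof. by move=> x y z; split=> [|/eqP ->]. Qed.

Fact true_equiv : equivalence_rel (fun _ _ : U => true).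
Proof. by []. Qed.

Definition part_bot := part_of eq_equiv.
Definition part_top := part_of true_equiv.

Fact refines_meet P Q S : refines P (part_meet Q S) = refines P Q && refines P S.
Proof.
apply/refinesP/andP => [sub | [/refinesP PQ /refinesP PS] x y xy].
  by split; apply/refinesP => x y /sub; rewrite same_block_part_of => /andP[].
by rewrite same_block_part_of PQ // PS.
Qed.

Fact refines_join P Q S : refines (part_join P Q) S = refines P S && refines Q S.
Proof.
apply/refinesP/andP => [sub | [/refinesP PS /refinesP QS] x y].
  by split; apply/refinesP => x y xy; apply: sub;
     rewrite same_block_part_of connect1 // /join_step xy ?orbT.
rewrite same_block_part_of => /connectP[p]; elim: p x => [|u p IHp] x /=.
  by move=> _ ->; have [-> _] := same_block_equiv S x x x.
case/andP=> xu pth yE; have := IHp _ pth yE.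
have {}xu : same_block S x u by case/orP: xu; [apply: PS | apply: QS].
by have [_ /(_ xu) ->] := same_block_equiv S x u y.
Qed.

Fact part_le0x P : refines part_bot P.
Proof.
apply/refinesP => x y; rewrite same_block_part_of => /eqP ->.
by have [-> _] := same_block_equiv P y y y.
Qed.

Fact part_lex1 P : refines P part_top.
Proof. by apply/refinesP => x y _; rewrite same_block_part_of. Qed.

End PartLattice.

HB.instance Definition _ (U : finType) :=
  Order.Le_isPOrder.Build part_display (part U)
    (@refines_refl U) (@refines_anti U) (@refines_trans U).
HB.instance Definition _ (U : finType) :=
  Order.POrder_MeetJoin_isLattice.Build part_display (part U)
    (@refines_meet U) (@refines_join U).
HB.instance Definition _ (U : finType) :=
  Order.hasBottom.Build part_display (part U) (@part_le0x U).
HB.instance Definition _ (U : finType) :=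
  Order.hasTop.Build part_display (part U) (@part_lex1 U).

Lemma leE_part (U : finType) (P Q : part U) : (P <= Q)%O = refines P Q.
Proof. by []. Qed.

Lemma blocks_bot (U : finType) : blocks (\bot%O : part U) = [set [set x] | x in U].
Proof.
have E (x : U) : [set y in [set: U] | x == y] = [set x].
  by apply/setP => y; rewrite !inE eq_sym.
apply/setP => B; apply/imsetP/imsetP => -[x _ ->]; exists x; rewrite ?inE //.
Qed.

Lemma blocks_top (U : finType) :
  0 < #|U| -> blocks (\top%O : part U) = [set [set: U]].
Proof.
case/card_gt0P=> x0 _; apply/setP => B; rewrite inE; apply/imsetP/eqP => [[x _ ->]|->].
  by apply/setP => y; rewrite !inE.
by exists x0 => //; apply/setP => y; rewrite !inE.
Qed.

Section SubLattice.
Variables (d : Order.disp_t).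
Local Open Scope order_scope.

Definition least (T : finPOrderType d) (L : {set T}) (b : T) : bool :=
  (b \in L) && [forall x in L, b <= x].

Definition greatest (T : finPOrderType d) (L : {set T}) (t : T) : bool :=
  (t \in L) && [forall x in L, x <= t].

Definition atoms (T : finPOrderType d) (L : {set T}) : {set T} :=
  [set a in L | [exists b, [&& least L b, b < a
                            & [forall x in L, ~~ ((b < x) && (x < a))]]]].

(* The join of S is computed in L, which need not be closed under the joins of
   the ambient order. *)
Definition join_in (T : finPOrderType d) (L S : {set T}) (x : T) : bool :=
  least [set y in L | [forall s in S, s <= y]] x.

Definition atomistic (T : finPOrderType d) (L : {set T}) : Prop :=
  (exists b, least L b) /\
  (forall x, x \in L -> exists2 S : {set T}, S \subset atoms L & join_in L S x).

Definition sublattice (T : finLatticeType d) (L : {set T}) : Prop :=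
  {in L &, forall x y, (x `&` y \in L) /\ (x `|` y \in L)}.

(* The complements are relative to the least and greatest elements of L, which
   may differ from those of T. *)
Definition boolean_sublattice (T : finLatticeType d) (L : {set T}) : Prop :=
  [/\ sublattice L,
      {in L & &, forall x y z, x `&` (y `|` z) = (x `&` y) `|` (x `&` z)}
    & exists b t, [/\ least L b, greatest L t
        & {in L, forall x, exists y, [/\ y \in L, x `&` y = b & x `|` y = t]}]].

End SubLattice.

Definition closure_system (U : finType) (Q : {set {set U}}) : Prop :=
  [set: U] \in Q /\
  (forall F : {set {set U}}, F \subset Q -> \bigcap_(A in F) A \in Q).

Definition semi_interval_system (U : finType) (I : {set {set U}}) : Prop :=
  [/\ closure_system I,
      set0 \in I /\ (forall x, [set x] \in I)
    & forall A B, A \in I -> B \in I -> A :&: B != set0 -> A :|: B \in I].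

Definition decomp (U : finType) (I : {set {set U}}) : {set part U} :=
  [set P : part U | blocks P \subset I].

(* A hypergraph with vertex set U is represented by its set of edges. *)
Definition hypergraph (U : finType) := {set {set U}}.

Definition hypergraph_of (U : finType) (D : {set part U}) : hypergraph U :=
  [set B in \bigcup_(P in D) blocks P | #|B| != 1].

(* The sequence v_0, B_1, v_1, ..., B_n, v_n is represented by v_0 and the list
   of the pairs (B_i, v_i). *)
Fixpoint hwalk (U : finType) (E : hypergraph U) (x : U) (s : seq ({set U} * U)) : bool :=
  if s is (B, y) :: s' then [&& B \in E, x \in B, y \in B & hwalk E y s'] else true.

(* v_0, ..., v_(n-1) are distinct and v_1, ..., v_n are distinct, so that
   v_0 = v_n is the only repetition allowed. *)
Definition hpath (U : finType) (E : hypergraph U) (x : U) (s : seq ({set U} * U)) : bool :=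
  [&& hwalk E x s, uniq (belast x (unzip2 s)), uniq (unzip2 s) & uniq (unzip1 s)].

Definition hconnected (U : finType) (E : hypergraph U) : Prop :=
  forall x y : U, x != y -> exists2 s, hpath E x s & last x (unzip2 s) = y.

(* The cycle v_1, B_1, ..., v_n, B_n, v_1 is represented by the list of the
   pairs (v_i, B_i); [cycle] states that the successor of v_i, in cyclic order,
   lies in B_i. *)
Definition hcycle (U : finType) (E : hypergraph U) (c : seq (U * {set U})) : bool :=
  [&& 2 < size c,
      all (fun vB : U * {set U} => (vB.2 \in E) && (vB.1 \in vB.2)) c,
      cycle (fun vB wC : U * {set U} => wC.1 \in vB.2) c,
      uniq (unzip1 c) & uniq (unzip2 c)].

Definition hypertree (U : finType) (E : hypergraph U) : Prop :=
  hconnected E /\ (forall c, ~~ hcycle E c).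

(* Main.v *)
(* For a set S of edges let [span S] be the partition into S-connected components.
   A linear hypergraph E is acyclic iff each edge B is a bridge: no two points of
   B are connected by the other edges. When all edges are bridges, S |-> span S
   turns intersections into meets, and always unions into joins, so the spans form
   a Boolean lattice; conversely distributivity makes every edge a bridge.
   If D(U, I) is atomistic, its elements are exactly the spans of sets of edges of
   the hypergraph of its atoms, which gives (ii). For (i), take for I the sets
   connected by the edges they contain. Then D(U, I) consists of all the spans, and
   it contains every competitor, whose elements are joins of atoms with blocks in I. *)
Require Import Defs.
From mathcomp Require Import all_boot all_order.

Set Implicit Arguments.
Unset Strict Implicit.
Unset Printing Implicit Defensive.

Import Order.TTheory.

Section Partitions.
Variable U : finType.
Implicit Types (P Q : part U) (x y z : U) (A B C : {set U}) (S T E I : {set {set U}}).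

(** * Partitions viewed as equivalence relations *)

Lemma same_block_refl P x : same_block P x x.
Proof. by have [] := same_block_equiv P x x x. Qed.

Lemma same_block_trans P : transitive (same_block P).
Proof. by move=> y x z h; have [_ /(_ h) ->] := same_block_equiv P x y z. Qed.

Lemma part_leP P Q :
  reflect (forall x y, same_block P x y -> same_block Q x y) (P <= Q)%O.
Proof. exact: refinesP. Qed.

Lemma same_block_meet P Q x y :
  same_block (P `&` Q)%O x y = same_block P x y && same_block Q x y.
Proof. exact: (same_block_part_of (meet_equiv P Q)). Qed.

Lemma same_block_bot x y : same_block (\bot%O : part U) x y = (x == y).
Proof. exact: (same_block_part_of (@eq_equiv U)). Qed.

Lemma same_block_top x y : same_block (\top%O : part U) x y.
Proof. by rewrite (same_block_part_of (@true_equiv U)). Qed.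

Lemma same_blockE P B x y : B \in blocks P -> x \in B -> same_block P x y = (y \in B).
Proof.
by move=> BP xB; have /and3P[_ tiP _] := partP P; rewrite /same_block (def_pblock tiP BP xB).
Qed.

Lemma mem_cover_part P x : x \in cover (blocks P).
Proof. by rewrite (cover_partition (partP P)) inE. Qed.

Lemma pblock_part P x : pblock (blocks P) x \in blocks P.
Proof. by rewrite pblock_mem ?mem_cover_part. Qed.

Lemma mem_pblock_part P x : x \in pblock (blocks P) x.
Proof. by rewrite mem_pblock mem_cover_part. Qed.

Lemma block_witness P B : B \in blocks P -> exists x, x \in B.
Proof.
by move=> BP; apply/set0Pn; apply: contraTneq BP => ->; have /and3P[] := partP P.
Qed.

Lemma part_neq_bot P : P != \bot%O -> exists x y, x != y /\ same_block P x y.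
Proof.
move=> Pn; have /existsP[x /existsP[y /andP[? ?]]] :
    [exists x, exists y, (x != y) && same_block P x y]; last by exists x, y.
apply: contraNT Pn => /existsPn h; apply/eqP/part_ext => x y.
rewrite same_block_bot; case: eqP => [->|/eqP xy]; first exact: same_block_refl.
by apply/negbTE; have /existsPn/(_ y) := h x; rewrite xy.
Qed.

Lemma neq_bot_part P x y : x != y -> same_block P x y -> P != \bot%O.
Proof. by move=> xy; apply: contraTneq => ->; rewrite same_block_bot. Qed.

Lemma part_le_block P Q B :
  (P <= Q)%O -> B \in blocks P -> exists2 C, C \in blocks Q & B \subset C.
Proof. by rewrite leE_part => /forall_inP h /h /exists_inP. Qed.

Lemma mem_decompP I P :
  reflect (forall x, pblock (blocks P) x \in I) (P \in decomp I).
Proof.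
rewrite inE; apply: (iffP subsetP) => [h x | h B BP]; first exact/h/pblock_part.
have [x xB] := block_witness BP.
have /and3P[_ tiP _] := partP P.
by rewrite -(def_pblock tiP BP xB).
Qed.

Lemma hypergraph_ofP (D : {set part U}) B :
  reflect (exists P, [/\ P \in D, B \in blocks P & 1 < #|B|]) (B \in hypergraph_of D).
Proof.
rewrite inE; apply: (iffP andP) => [[/bigcupP[P PD BP] B1] | [P [PD BP B1]]].
  exists P; split=> //; have [x xB] := block_witness BP.
  by rewrite ltn_neqAle eq_sym B1; apply/card_gt0P; exists x.
by split; [apply/bigcupP; exists P | rewrite neq_ltn B1 orbT].
Qed.

(** * Partitions into the connected components of a family of sets *)

Definition adj S : rel U := fun x y => [exists B in S, (x \in B) && (y \in B)].

Lemma adjP S x y : reflect (exists B, [/\ B \in S, x \in B & y \in B]) (adj S x y).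
Proof.
by apply: (iffP exists_inP) => [[B BS /andP[]]|[B [BS xB yB]]]; exists B => //; apply/andP.
Qed.

Lemma adj_connect S B x y : B \in S -> x \in B -> y \in B -> connect (adj S) x y.
Proof. by move=> BS xB yB; apply/connect1/adjP; exists B. Qed.

Lemma adj_sym S : connect_sym (adj S).
Proof.
by apply: sym_connect_sym => x y; apply/adjP/adjP => -[B []]; exists B.
Qed.

Lemma connect_adjS S T x y :
  S \subset T -> connect (adj S) x y -> connect (adj T) x y.
Proof.
move=> ST; apply: connect_sub => {x y} x y /adjP[B [/(subsetP ST) BT xB yB]].
exact: adj_connect BT xB yB.
Qed.

Fact adj_equiv S : equivalence_rel (connect (adj S)).
Proof. by move=> x y z; split=> [|xy]; [exact: connect0 | apply: (same_connect (@adj_sym S))]. Qed.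

Definition span S : part U := part_of (adj_equiv S).

Lemma same_block_span S x y : same_block (span S) x y = connect (adj S) x y.
Proof. exact: same_block_part_of. Qed.

(** The universal property of [span]: comparing a span with a partition reduces to single members of
    [S], by induction along a connecting path. *)
Lemma span_leP S P :
  reflect (forall B x y, B \in S -> x \in B -> y \in B -> same_block P x y) (span S <= P)%O.
Proof.
apply: (iffP (part_leP _ _)) => [h B x y BS xB yB | h x y].
  by apply: h; rewrite same_block_span; apply: adj_connect BS xB yB.
rewrite same_block_span => /connectP[p]; elim: p x => [|z p IHp] x /=.
  by move=> _ ->; apply: same_block_refl.
case/andP=> /adjP[B [BS xB zB]] pth yE; apply: same_block_trans (IHp _ pth yE).
exact: h BS xB zB.
Qed.

Lemma span_mono S T : S \subset T -> (span S <= span T)%O.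
Proof.
by move=> ST; apply/part_leP => x y; rewrite !same_block_span; apply: connect_adjS.
Qed.

Lemma span0 : span set0 = \bot%O.
Proof.
by apply/eqP; rewrite -lex0; apply/span_leP => B x y; rewrite inE.
Qed.

Lemma span1_block B x y : same_block (span [set B]) x y -> x != y -> x \in B /\ y \in B.
Proof.
rewrite same_block_span => h xy.
have closB z w : connect (adj [set B]) z w -> z != w -> z \in B.
  move=> /connectP[[|t p] /= + ->]; first by rewrite eqxx.
  by case/andP=> /adjP[B' []]; rewrite inE => /eqP -> ->.
by split; [apply: closB xy | rewrite adj_sym in h; apply: closB h _; rewrite eq_sym].
Qed.

Lemma spanU S T : span (S :|: T) = (span S `|` span T)%O.
Proof.
apply/le_anti/andP; split; last by rewrite leUx !span_mono ?subsetUl ?subsetUr.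
apply/span_leP => B x y; rewrite inE => /orP[] BST xB yB.
  by apply: (part_leP _ _ (leUl _ _)); rewrite same_block_span; apply: adj_connect BST xB yB.
by apply: (part_leP _ _ (leUr _ _)); rewrite same_block_span; apply: adj_connect BST xB yB.
Qed.

(** Every partition is thus a span, so joins of partitions can be computed as spans of unions. *)
Lemma span_blocks P : span (blocks P) = P.
Proof.
apply/le_anti/andP; split.
  by apply/span_leP => B x y BP xB yB; rewrite (same_blockE y BP xB).
apply/part_leP => x y xy; rewrite same_block_span.
exact: adj_connect (pblock_part P x) (mem_pblock_part P x) xy.
Qed.

(** * Hypergraphs whose edges are all bridges *)

Definition bridges E := forall B x y, B \in E -> x \in B -> y \in B -> x != y ->
  ~~ connect (adj (E :\ B)) x y.

Definition linear_hypergraph E := forall B C x y, B \in E -> C \in E ->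
  x \in B -> y \in B -> x \in C -> y \in C -> x != y -> B = C.

(** A second edge through [x] and [y] would survive the removal of [B] and still connect them. *)
Lemma bridges_linear E : bridges E -> linear_hypergraph E.
Proof.
move=> brE B C x y BE CE xB yB xC yC xy; apply/eqP; apply: contraT => BC.
have := brE _ _ _ BE xB yB xy; rewrite (@adj_connect _ C) // !inE CE andbT.
by rewrite eq_sym.
Qed.

(** If the path uses [B] at all, [p] is where its first step along [B] starts and [q] is where its
    last such step ends. *)
Lemma connect_adjD1 S B x y : connect (adj S) x y ->
  connect (adj (S :\ B)) x y \/
  exists p q, [/\ p \in B, q \in B, connect (adj (S :\ B)) x p
                & connect (adj (S :\ B)) q y].
Proof.
move=> /connectP[s]; elim: s x => [|z s IHs] x /= => [_ ->|]; first by left; apply: connect0.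
case/andP=> /adjP[C [CS xC zC]] pth yE.
have [CB|CB] := eqVneq C B.
  rewrite {}CB in xC zC; right; case: (IHs _ pth yE) => [zy|[p [q [pB qB _ qy]]]].
    by exists x, z; split=> //; apply: connect0.
  by exists x, q; split=> //; apply: connect0.
have xz : connect (adj (S :\ B)) x z by apply: adj_connect zC => //; rewrite !inE CB.
case: (IHs _ pth yE) => [zy|[p [q [pB qB zp qy]]]]; first by left; apply: connect_trans zy.
by right; exists p, q; split=> //; apply: connect_trans zp.
Qed.

(* An edge of [S] outside [T] can be dropped: otherwise the [S]-path crosses it
   between two distinct points that are also linked by the rest of the path and
   the [T]-path. *)
Lemma connect_adjI E S T x y : bridges E -> S \subset E -> T \subset E ->
  connect (adj S) x y -> connect (adj T) x y -> connect (adj (S :&: T)) x y.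
Proof.
move=> brE; elim: {S}#|S :\: T| {-2}S (leqnn #|S :\: T|) => [|n IHn] S.
  rewrite leqn0 cards_eq0 setD_eq0 => /setIidPl <- *.
  by rewrite -setIA setIid.
move=> leSn SE TE Sxy Txy.
have [|/set0Pn[B]] := eqVneq (S :\: T) set0.
  by move/eqP; rewrite setD_eq0 => /setIidPl ->.
rewrite inE => /andP[BT BS].
have SBE : S :\ B \subset E :\ B by apply: setSD.
have TBE : T \subset E :\ B by rewrite subsetD1 TE.
have SBxy : connect (adj (S :\ B)) x y.
  case: (connect_adjD1 B Sxy) => // -[p [q [pB qB xp qy]]].
  have [pq|pq] := eqVneq p q; first by apply: connect_trans xp _; rewrite pq.
  have := brE _ _ _ (subsetP SE _ BS) pB qB pq; rewrite (@connect_trans _ _ x) //.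
    by rewrite adj_sym; apply: connect_adjS xp.
  apply: connect_trans (connect_adjS TBE Txy) _.
  by rewrite adj_sym; apply: connect_adjS qy.
apply: (@connect_adjS ((S :\ B) :&: T)); first by apply: setSI; apply: subD1set.
apply: IHn => //; last by apply: subset_trans SE; apply: subD1set.
rewrite -ltnS; apply: leq_trans leSn; apply: proper_card.
apply/properP; split; first by apply: setSD; apply: subD1set.
by exists B; rewrite !inE ?BT ?BS // eqxx.
Qed.

Lemma spanI E S T : bridges E -> S \subset E -> T \subset E ->
  span (S :&: T) = (span S `&` span T)%O.
Proof.
move=> brE SE TE; apply/le_anti/andP; split.
  by rewrite lexI !span_mono ?subsetIl ?subsetIr.
apply/part_leP => x y; rewrite same_block_meet !same_block_span => /andP[].
exact: connect_adjI brE SE TE.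
Qed.

(** The Boolean laws are carried over from the power set of [E]; in particular [span (E :\: S)] is a
    complement of [span S]. *)
Lemma boolean_spans E (L : {set part U}) : bridges E ->
  (forall P, P \in L <-> exists2 S : {set {set U}}, S \subset E & P = span S) -> boolean_sublattice L.
Proof.
move=> brE LE.
have inL S : S \subset E -> span S \in L by move=> SE; apply/LE; exists S.
split.
- move=> P Q /LE[S SE ->] /LE[T TE ->].
  rewrite -(spanI brE) // -spanU; split; apply: inL.
    by apply: subset_trans SE; apply: subsetIl.
  by rewrite subUset SE.
- move=> P Q R /LE[S SE ->] /LE[T TE ->] /LE[W WE ->].
  by rewrite -spanU -!(spanI brE) ?subUset ?TE // setIUr spanU.
exists (span set0), (span E); split.
- rewrite /least inL ?sub0set //; apply/forall_inP => _ /LE[S _ ->].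
  by rewrite span_mono ?sub0set.
- by rewrite /greatest inL //; apply/forall_inP => _ /LE[S SE ->]; apply: span_mono.
move=> _ /LE[S SE ->]; exists (span (E :\: S)).
rewrite inL ?subsetDl // -(spanI brE) ?subsetDl // -spanU; split=> //.
  by congr span; apply/setP => B; rewrite !inE; case: (B \in S).
congr span; apply/setP => B; rewrite !inE.
by case: (boolP (B \in S)) => //= /(subsetP SE) ->.
Qed.

(** * Walks, simple paths and cycles *)

(** Keeping only the tail from the last visit to [B] leaves a walk that can be prefixed by one step
    along [B] without repeating a vertex or an edge. *)
Lemma hwalk_last_visit E B x s :
  hwalk E x s -> uniq (x :: unzip2 s) -> uniq (unzip1 s) -> has (mem B) (x :: unzip2 s) ->
  exists w t, [/\ hwalk E w t, uniq (w :: unzip2 t), uniq (unzip1 t),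
    last w (unzip2 t) = last x (unzip2 s) & w \in B /\ ~~ has (mem B) (unzip2 t)].
Proof.
elim: s x => [|[C y] s IHs] x.
  by move=> _ _ _ /=; rewrite orbF => xB; exists x, [::].
move=> hw ux uC hB; have [hB'|hB'] := boolP (has (mem B) (y :: unzip2 s)).
  have /and4P[_ _ _ hw'] := hw; case/andP: ux => _ uy; case/andP: uC => _ uC'.
  by have [w [t [? ? ? ? ?]]] := IHs y hw' uy uC' hB'; exists w, t; split.
exists x, ((C, y) :: s); split=> //; split=> //.
by move: hB; rewrite -cat1s has_cat (negbTE hB') orbF /= orbF.
Qed.

Lemma hwalk_edge E x s B :
  hwalk E x s -> B \in unzip1 s -> has (mem B) (unzip2 s).
Proof.
elim: s x => //= -[C y] s IHs x /and4P[_ _ yC hw]; rewrite inE.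
by case/orP=> [/eqP ->|/(IHs _ hw) ->]; rewrite /= ?yC ?orbT.
Qed.

(** By induction on the path: when a step along [B] is prefixed, the simple walk already found is
    first cut at its last vertex [w] in [B], and [B] then leads directly from [x] to [w]. *)
Lemma connect_simple_walk E x y : connect (adj E) x y ->
  exists s, [/\ hwalk E x s, uniq (x :: unzip2 s), uniq (unzip1 s) & last x (unzip2 s) = y].
Proof.
case/connectP=> p; elim: p x => [|z p IHp] x /=; first by move=> _ ->; exists [::].
case/andP=> /adjP[B [BE xB zB]] pth yE; have [s [hw us uB ls]] := IHp _ pth yE.
have [|w [t [hwt ut uBt lt [wB tB]]]] := hwalk_last_visit hw us uB (B := B).
  by apply/hasP; exists z; rewrite ?mem_head.
have [xw|xw] := eqVneq x w; first by exists t; rewrite xw lt ls.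
exists ((B, w) :: t); split; rewrite ?[hwalk _ _ _]/= ?BE ?xB ?wB ?hwt /= ?lt ?ls //.
  rewrite /= in ut; rewrite ut inE (negbTE xw) /= andbT.
  by apply: contra tB => xt; apply/hasP; exists x.
by rewrite uBt andbT; apply: contra tB; apply: hwalk_edge hwt.
Qed.

Lemma hwalk_connect E x s : hwalk E x s -> connect (adj E) x (last x (unzip2 s)).
Proof.
elim: s x => [|[B y] s IHs] x /=; first by rewrite connect0.
by case/and4P=> BE xB yB /IHs; apply: connect_trans; apply: adj_connect BE xB yB.
Qed.

Lemma hconnectedP E : hconnected E <-> forall x y, connect (adj E) x y.
Proof.
split=> [hE x y | hE x y xy].
  have [->|xy] := eqVneq x y; first exact: connect0.
  by have [s /and4P[hw _ _ _] <-] := hE _ _ xy; apply: hwalk_connect hw.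
have [s [hw us uB ls]] := connect_simple_walk (hE x y); exists s => //.
apply/and4P; split=> //; last by case/andP: us.
by move: us; rewrite lastI rcons_uniq => /andP[].
Qed.

Lemma hwalk_path E A B D x y z s : hwalk E x s -> x \in A -> y \in B ->
  path (fun vB wC : U * {set U} => wC.1 \in vB.2) (z, A)
    (rcons (zip (x :: unzip2 s) (rcons (unzip1 s) B)) (y, D)).
Proof.
move=> + + yB; elim: s x z A => [|[C w] s IHs] x z A /=; first by move=> _ ->; rewrite yB.
by case/and4P=> _ _ wC hw ->; apply: IHs.
Qed.

(** If [B] is not a bridge, a simple walk between two of its points that avoids [B] is closed by [B]
    to a cycle. *)
Lemma acyclic_bridges E :
  linear_hypergraph E -> (forall c, ~~ hcycle E c) -> bridges E.
Proof.
move=> linE acE B x y BE xB yB xy; apply/negP => /connect_simple_walk[s [hw us uB ls]].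
have BsN : B \notin unzip1 s.
  elim: s x hw {us uB ls xB xy} => //= -[C z] s IHs x /and4P[].
  rewrite !inE => /andP[CB _] _ _ /IHs hB.
  by rewrite eq_sym (negbTE CB).
(* Each vertex is paired with the edge by which the walk leaves it, and the endpoint [y] with the
   closing edge [B]. *)
pose c := zip (x :: unzip2 s) (rcons (unzip1 s) B).
have szE : size (x :: unzip2 s) = size (rcons (unzip1 s) B).
  by rewrite size_rcons /= !size_map.
have /negP := acE c; apply; apply/and5P; split.
(* A walk with a single edge would give a cycle of length two, but then that edge and [B] share [x]
   and [y], against linearity. *)
- rewrite /c size_zip -szE minnn /= size_map.
  case: s hw us ls {uB BsN c szE} => [|[C z] [|? ?]] //=.
    by move=> _ _ E'; rewrite E' eqxx in xy.
  rewrite !inE andbT => /and3P[/andP[CB CE] xC zC] _ zy.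
  by rewrite zy in zC; rewrite (linE C B x y) ?eqxx in CB.
- rewrite /c; elim: s x hw ls {us uB BsN xB xy c szE} => [|[C z] s IHs] x /=.
    by move=> _ ->; rewrite BE yB.
  case/and4P; rewrite !inE => /andP[_ CE] xC _ hw ls.
  by rewrite CE xC IHs.
- rewrite /c; case: s hw {us uB BsN c szE ls} => [|[C z] s] /=; first by rewrite xB.
  by case/and4P=> _ _ zC hw; apply: hwalk_path hw zC xB.
- by rewrite /c unzip1_zip // szE.
- by rewrite /c unzip2_zip ?szE // rcons_uniq BsN.
Qed.

(** The edges of a cycle are distinct, so after its first edge [B] the rest leads from [y] back to
    [x] without [B]. *)
Lemma hcycle_bridge E c : bridges E -> ~~ hcycle E c.
Proof.
move=> brE; apply/negP => /and5P[].
case: c => [|[x B] [|[y C] c]] // _ /allP allc cyc ux uB.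
have xy : x != y by move: ux; rewrite /= inE; case: eqP.
have /andP[BE xB] : (B \in E) && (x \in B) by apply: (allc (x, B)); rewrite mem_head.
have yB : y \in B by move: cyc; rewrite /= => /andP[].
have := brE _ _ _ BE yB xB; rewrite eq_sym xy => /(_ isT)/negP; apply.
have {}cyc : path (fun vB wC : U * {set U} => wC.1 \in vB.2) (y, C) (rcons c (x, B)).
  by move: cyc; rewrite /= => /andP[].
have allc' : all (fun vC : U * {set U} => (vC.2 \in E :\ B) && (vC.1 \in vC.2)) ((y, C) :: c).
  apply/allP => -[z D] zD; have /andP[/= DE zD'] : (D \in E) && (z \in D).
    by apply: (allc (z, D)); rewrite inE zD orbT.
  rewrite /= !inE DE zD' !andbT; apply: contraTneq uB => DB.
  by rewrite /= -DB (map_f snd zD).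
elim: c y C {allc ux uB xy yB} cyc allc' => [|[z D] c IHc] y C /=.
  rewrite !andbT => xC /andP[CE yC]; exact: adj_connect CE yC xC.
case/andP=> zC cyc /and3P[/andP[CE yC] zD allc].
apply: connect_trans (adj_connect CE yC zC) _; apply: IHc cyc _.
by rewrite /= zD.
Qed.


(** * Atoms of families of partitions *)

Lemma atomsP (L : {set part U}) P : \bot%O \in L ->
  reflect [/\ P \in L, P != \bot%O & forall Q, Q \in L -> Q != \bot%O -> (Q <= P)%O -> Q = P]
          (P \in atoms L).
Proof.
move=> botL.
have leastE b : least L b = (b == \bot%O).
  apply/andP/eqP => [[_ /forall_inP/(_ _ botL)]|->]; first by rewrite lex0 => /eqP.
  by split=> //; apply/forall_inP => Q _; apply: le0x.
rewrite inE; apply: (iffP andP) => [[PL /existsP[b]]|[PL Pn minP]].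
  rewrite leastE => /and3P[/eqP -> bP /forall_inP minP]; split=> //; first by rewrite -lt0x.
  move=> Q /minP; rewrite lt0x le_eqVlt => QP Qn /predU1P[//|ltQP].
  by rewrite Qn ltQP in QP.
split=> //; apply/existsP; exists \bot%O; rewrite leastE eqxx lt0x Pn /=.
apply/forall_inP => Q QL; rewrite lt0x negb_and negbK.
have [//|Qn /=] := eqVneq Q \bot%O; apply/negP => QP.
by move: (QP); rewrite (minP Q QL Qn (ltW QP)) ltxx.
Qed.

Lemma atom_below (L : {set part U}) P : \bot%O \in L -> P \in L -> P != \bot%O ->
  exists2 A, A \in atoms L & (A <= P)%O.
Proof.
move=> botL PL Pn.
pose ok Q := [&& Q \in L, Q != \bot%O & (Q <= P)%O].
have okP : ok P by rewrite /ok PL Pn lexx.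
(* The size of the down-set is a strictly monotone rank, so minimizing it yields a minimal
   element. *)
case: (@arg_minnP _ P ok (fun Q => #|[set R : part U | (R <= Q)%O]|) okP).
move=> A /and3P[AL An AP] minA; exists A => //; apply/atomsP => //; split=> // Q QL Qn QA.
apply/eqP; rewrite eq_le QA /=; apply: contraT => AQ.
have /minA : ok Q by rewrite /ok QL Qn (le_trans QA).
rewrite leqNgt => /negP[]; apply: proper_card; apply/properP; split.
  by apply/subsetP => R; rewrite !inE => /le_trans; apply.
by exists A; rewrite !inE ?lexx.
Qed.

(** In a finite Boolean lattice every element is a join of atoms. A largest [Q] below [P] in both
    [L] and [D] must be [P], since otherwise an atom below [P] and the complement of [Q] could be
    joined to it. *)
Lemma boolean_atoms_generate (L D : {set part U}) : boolean_sublattice L ->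
  \bot%O \in L -> \bot%O \in D -> atoms L \subset D ->
  {in D &, forall P Q, (P `|` Q)%O \in D} -> L \subset D.
Proof.
move=> [subL distL [b [t [lb gt compL]]]] botL botD atD joinD.
have {lb} bE : b = \bot%O.
  by case/andP: lb => _ /forall_inP/(_ _ botL); rewrite lex0 => /eqP.
apply/subsetP => P PL.
pose ok Q := [&& Q \in L, Q \in D & (Q <= P)%O].
have ok0 : ok \bot%O by rewrite /ok botL botD le0x.
case: (@arg_maxnP _ \bot%O ok (fun Q => #|[set R : part U | (R <= Q)%O]|) ok0).
move=> Q /and3P[QL QD QP] maxQ.
have [<- //|QnP] := eqVneq Q P.
have [Q' [Q'L QQ'0 QQ'1]] := compL Q QL.
have [PQ'L _] := subL _ _ PL Q'L.
have PQ'n : (P `&` Q')%O != \bot%O.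
  (* If [P] met the complement [Q'] trivially, distributing [P] over [Q] joined with [Q'] would give
     [P = Q]. *)
  apply: contraNneq QnP => PQ'0; rewrite eq_sym -(meet_r QP) -[(P `&` Q)%O]joinx0 -PQ'0.
  rewrite -distL // QQ'1; apply/eqP; rewrite meet_l //.
  by case/andP: gt => _ /forall_inP; apply.
have [A Aat] := atom_below botL PQ'L PQ'n; rewrite lexI => /andP[AP AQ'].
have [AL An _] := atomsP _ botL Aat.
have [_ QAL] := subL _ _ QL AL.
have /maxQ : ok (Q `|` A)%O by rewrite /ok QAL leUx QP AP joinD //; apply: (subsetP atD).
rewrite /= leqNgt => /negP[]; apply: proper_card; apply/properP; split.
  by apply/subsetP => R; rewrite !inE => /le_trans; apply; apply: leUl.
(* An atom below both [Q] and its complement would be the bottom, so joining [A] strictly enlarges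
   [Q]. *)
exists A; rewrite !inE ?leUr //; apply: contra An => AQ.
by rewrite -lex0 -bE -QQ'0 lexI AQ.
Qed.

(** Atoms with blocks sharing two points have a nontrivial meet, hence are equal, and overlapping
    blocks of one partition coincide. *)
Lemma atoms_linear (L : {set part U}) : sublattice L -> \bot%O \in L ->
  linear_hypergraph (hypergraph_of (atoms L)).
Proof.
move=> subL botL B C x y /hypergraph_ofP[P [Pat BP _]] /hypergraph_ofP[Q [Qat CQ _]].
move=> xB yB xC yC xy.
have [PL _ minP] := atomsP _ botL Pat; have [QL _ minQ] := atomsP _ botL Qat.
have [PQL _] := subL _ _ PL QL.
have PQn : (P `&` Q)%O != \bot%O.
  by apply: (neq_bot_part xy); rewrite same_block_meet (same_blockE _ BP) // yB (same_blockE _ CQ).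
have PQ : P = Q by rewrite -(minP _ PQL PQn (leIl _ _)) (minQ _ PQL PQn (leIr _ _)).
have /and3P[_ tiP _] := partP P.
by rewrite -(def_pblock tiP BP xB) PQ; rewrite PQ in tiP; rewrite (def_pblock tiP CQ xC).
Qed.

(** * Partitions with blocks in a semi-interval system *)

Lemma closure_systemI I A B : closure_system I -> A \in I -> B \in I -> A :&: B \in I.
Proof.
case=> _ capI AI BI; have -> : A :&: B = \bigcap_(C in [set A; B]) C.
  apply/setP => x; apply/setIP/bigcapP => [[xA xB] C|h]; first by case/set2P=> ->.
  by split; apply: h; rewrite !inE eqxx ?orbT.
by apply: capI; apply/subsetP => C /set2P[] ->.
Qed.

(** A largest member of [I] that contains [x] and lies in its component absorbs every set of [S] it
    meets, by the union axiom, and so is the whole component. *)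
Lemma span_decomp I S : semi_interval_system I -> S \subset I -> span S \in decomp I.
Proof.
move=> [_ [_ sgI] unI] SI; apply/mem_decompP => x.
set C := pblock _ _.
pose ok A := [&& A \in I, x \in A & A \subset C].
have ok1 : ok [set x] by rewrite /ok sgI set11 sub1set mem_pblock_part.
case: (@arg_maxnP _ [set x] ok (fun A => #|A|) ok1) => A /and3P[AI xA AC] maxA.
suff CA : C \subset A by rewrite (_ : C = A) //; apply/eqP; rewrite eqEsubset CA.
have adjC y : y \in C = connect (adj S) x y by rewrite -same_block_span.
have closA y z : adj S y z -> y \in A -> z \in A.
  case/adjP=> B [BS yB zB] yA.
  have /maxA : ok (A :|: B).
    apply/and3P; split; [|by rewrite inE xA|].
      by apply: unI => //; [apply: (subsetP SI)|apply/set0Pn; exists y; rewrite inE yA].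
    rewrite subUset AC; apply/subsetP => w wB; rewrite adjC.
    by apply: connect_trans (adj_connect BS yB wB); rewrite -adjC (subsetP AC).
  move=> le; have /eqP -> : A == A :|: B by rewrite eqEcard subsetUl.
  by rewrite inE zB orbT.
apply/subsetP => y; rewrite adjC => /connectP[p].
elim: p x xA {ok ok1 maxA AC adjC C} => [|w p IHp] z zA /=; first by move=> _ ->.
by case/andP=> /closA/(_ zA); apply: IHp.
Qed.

Lemma decomp_bot I : semi_interval_system I -> \bot%O \in decomp I.
Proof. by move=> sI; rewrite -span0 span_decomp ?sub0set. Qed.

Lemma decomp_top I : semi_interval_system I -> \top%O \in decomp I.
Proof.
move=> [[TI _] _ _]; apply/mem_decompP => x; rewrite (_ : pblock _ _ = setT) //.
by apply/setP => y; rewrite inE; apply: same_block_top.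
Qed.

Lemma decomp_join I P Q : semi_interval_system I ->
  P \in decomp I -> Q \in decomp I -> (P `|` Q)%O \in decomp I.
Proof.
move=> sI; rewrite -{2}(span_blocks P) -{2}(span_blocks Q) -spanU !inE => PI QI.
by have := span_decomp sI; rewrite /decomp => /(_ (blocks P :|: blocks Q)); rewrite inE subUset PI QI; apply.
Qed.

Lemma decomp_sublattice I : semi_interval_system I -> sublattice (decomp I).
Proof.
move=> sI P Q PD QD; split; last exact: decomp_join.
have [cI _ _] := sI.
apply/mem_decompP => x; rewrite (_ : pblock _ _ = pblock (blocks P) x :&: pblock (blocks Q) x).
  by apply: closure_systemI => //; exact/mem_decompP.
by apply/setP => y; rewrite inE; apply: same_block_meet.
Qed.

(** * Recovering a partition from the edges inside its blocks *)

Definition edges_below E P := [set B in E | [exists C in blocks P, B \subset C]].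

Lemma edges_belowS E P : edges_below E P \subset E.
Proof. by apply/subsetP => B; rewrite inE => /andP[]. Qed.

Lemma span_edges_below E P : (span (edges_below E P) <= P)%O.
Proof.
apply/span_leP => B x y; rewrite inE => /andP[_ /exists_inP[C CP BC]] xB yB.
by rewrite (same_blockE _ CP) (subsetP BC).
Qed.

Lemma atoms_edges_decomp I : hypergraph_of (atoms (decomp I)) \subset I.
Proof.
apply/subsetP => B /hypergraph_ofP[P [+ BP _]].
by rewrite inE => /andP[+ _]; rewrite inE => /subsetP; apply.
Qed.

(** The span of the edges below [P] bounds every atom in a family with join [P]. As that join is
    taken inside [decomp I], the span must also be shown to lie there before it can be compared with
    [P]. *)
Lemma atomistic_span I P : semi_interval_system I -> atomistic (decomp I) ->
  P \in decomp I -> P = span (edges_below (hypergraph_of (atoms (decomp I))) P).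
Proof.
move=> sI [_ atI] PD; set E := hypergraph_of _.
apply/le_anti; rewrite span_edges_below andbT.
have [S /subsetP Sat /andP[+ /forall_inP leP]] := atI P PD.
rewrite inE => /andP[_ /forall_inP SP]; apply: leP; rewrite inE.
rewrite span_decomp ?(subset_trans (edges_belowS _ _)) ?atoms_edges_decomp //=.
apply/forall_inP => Q QS; apply/part_leP => x y xy.
have [<-|xny] := eqVneq x y; first exact: same_block_refl.
rewrite same_block_span; apply: (@adj_connect _ (pblock (blocks Q) x)); rewrite ?mem_pblock_part //.
rewrite inE; apply/andP; split.
  apply/hypergraph_ofP; exists Q; rewrite pblock_part Sat //; split=> //.
  by apply/card_gt1P; exists x, y; rewrite mem_pblock_part.
have [C CP QC] := part_le_block (SP Q QS) (pblock_part Q x).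
by apply/exists_inP; exists C.
Qed.

(** Shared by (i) and (ii), which differ in how members of [decomp I] are recognized as spans. *)
Lemma boolean_decomp E I : semi_interval_system I -> bridges E -> E \subset I ->
  (forall P, P \in decomp I -> P = span (edges_below E P)) -> boolean_sublattice (decomp I).
Proof.
move=> sI brE EI spanE; apply: (boolean_spans brE) => P; split=> [/spanE PE | [S SE ->]].
  by exists (edges_below E P); first exact: edges_belowS.
by apply: span_decomp => //; apply: subset_trans SE EI.
Qed.

(* By distributivity, an edge meets the join of the other edges in the join of
   the pairwise meets, which are trivial by linearity. *)
Lemma distributive_bridges I E : semi_interval_system I -> E \subset I ->
  linear_hypergraph E ->
  {in decomp I & &, forall P Q R, (P `&` (Q `|` R) = (P `&` Q) `|` (P `&` R))%O} ->
  bridges E.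
Proof.
move=> sI EI linE dist B x y BE xB yB xy.
have inD S : S \subset E -> span S \in decomp I.
  by move=> SE; apply: span_decomp => //; apply: subset_trans SE EI.
have meet0 S : S \subset E :\ B -> (span [set B] `&` span S = \bot)%O.
  elim: {S}#|S| {-2}S (leqnn #|S|) => [|n IHn] S.
    by rewrite leqn0 cards_eq0 => /eqP -> _; rewrite span0 meetx0.
  move=> leS SEB; have [->|/set0Pn[C CS]] := eqVneq S set0; first by rewrite span0 meetx0.
  have /setD1P[CB CE] := subsetP SEB _ CS.
  have SE : S \subset E by apply: subset_trans SEB (subD1set _ _).
  rewrite -(setD1K CS) spanU dist ?inD ?sub1set ?(subset_trans (subD1set _ _)) //.
  have -> : (span [set B] `&` span (S :\ C) = \bot)%O.
    apply: IHn; first by move: leS; rewrite (cardsD1 C) CS.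
    by apply: subset_trans SEB; apply: subD1set.
  rewrite joinx0.
  apply/eqP; apply: contraT => /part_neq_bot[z [w [zw]]].
  rewrite same_block_meet => /andP[/span1_block/(_ zw)[zB wB] /span1_block/(_ zw)[zC wC]].
  by rewrite (linE C B z w) ?eqxx in CB.
apply/negP; rewrite -same_block_span => EBxy.
have : same_block (span [set B] `&` span (E :\ B))%O x y.
  rewrite same_block_meet EBxy andbT same_block_span.
  by apply: adj_connect xB yB; rewrite inE.
by rewrite meet0 // same_block_bot (negbTE xy).
Qed.

(** * The semi-interval system of connected sets *)

Definition connected_sets E : {set {set U}} :=
  [set A : {set U} | [forall x in A, forall y in A,
     connect (adj [set B in E | B \subset A]) x y]].

Lemma connected_setsP E A :
  reflect {in A &, forall x y, connect (adj [set B in E | B \subset A]) x y}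
          (A \in connected_sets E).
Proof.
rewrite inE; apply: (iffP forall_inP) => h x; first by move=> y xA; move/forall_inP: (h x xA); apply.
by move=> xA; apply/forall_inP => y; apply: h.
Qed.

Lemma edges_connected_sets E : E \subset connected_sets E.
Proof.
apply/subsetP => B BE; apply/connected_setsP => x y xB yB.
by apply: adj_connect xB yB; rewrite inE BE subxx.
Qed.

Lemma connected_setsW E A C x y : A \in connected_sets E -> A \subset C ->
  x \in A -> y \in A -> connect (adj [set B in E | B \subset C]) x y.
Proof.
move=> /connected_setsP Aco AC xA yA; apply: connect_adjS (Aco x y xA yA).
by apply/subsetP => B; rewrite !inE => /andP[-> /subset_trans]; apply.
Qed.

(** The edges inside an intersection are those inside both sets, so [connect_adjI] gives closure
    under intersection; two overlapping connected sets are linked through a common point. *)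
Lemma semi_interval_connected_sets E : bridges E -> hconnected E ->
  semi_interval_system (connected_sets E).
Proof.
move=> brE /hconnectedP cE.
have TE : [set: U] \in connected_sets E.
  apply/connected_setsP => x y _ _; apply: connect_adjS (cE x y).
  by apply/subsetP => B BE; rewrite inE BE subsetT.
split; [split=> //| split |].
(* By finiteness, only the empty intersection, which is the full set, and binary intersections need
   checking. *)
- move=> F /subsetP FE; apply: (big_ind (fun A => A \in connected_sets E)) => // A C Aco Cco.
  apply/connected_setsP => x y /setIP[xA xC] /setIP[yA yC].
  have -> : [set B in E | B \subset A :&: C] =
      [set B in E | B \subset A] :&: [set B in E | B \subset C].
    by apply/setP => B; rewrite !inE subsetI; case: (B \in E).
  apply: (connect_adjI brE); first by apply/subsetP => B; rewrite inE => /andP[].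
  + by apply/subsetP => B; rewrite inE => /andP[].
  + exact/connected_setsP.
  + exact/connected_setsP.
- by apply/connected_setsP => x y; rewrite inE.
- by move=> x; apply/connected_setsP => y z /set1P -> /set1P ->; apply: connect0.
move=> A C Aco Cco /set0Pn[z /setIP[zA zC]]; apply/connected_setsP => x y xAC yAC.
have toz w : w \in A :|: C -> connect (adj [set B in E | B \subset A :|: C]) w z.
  case/setUP=> wAC; first by apply: connected_setsW Aco _ wAC zA; apply: subsetUl.
  by apply: connected_setsW Cco _ wAC zC; apply: subsetUr.
by apply: connect_trans (toz x xAC) _; rewrite adj_sym toz.
Qed.

Lemma decomp_connected_sets E P :
  P \in decomp (connected_sets E) -> P = span (edges_below E P).
Proof.
move=> /mem_decompP Pco; apply/le_anti; rewrite span_edges_below andbT.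
apply/part_leP => x y xy; rewrite same_block_span.
have /connected_setsP Cco := Pco x.
apply: connect_adjS (Cco x y (mem_pblock_part P x) xy).
apply/subsetP => B; rewrite !inE => /andP[-> BC] /=.
by apply/exists_inP; exists (pblock (blocks P) x); first exact: pblock_part.
Qed.

Lemma span1_blocks B : B != set0 -> B \in blocks (span [set B]).
Proof.
case/set0Pn=> x xB; suff eB : pblock (blocks (span [set B])) x = B by rewrite -{1}eB pblock_part.
apply/setP => y; apply/idP/idP; last first.
  move=> yB; rewrite -[_ \in _]/(same_block _ x y) same_block_span.
  by apply: adj_connect xB yB; rewrite inE.
have [<- //|xy] := eqVneq x y => h.
by have [] := span1_block (h : same_block _ x y) xy.
Qed.

(** The atoms are the spans of single edges: each nontrivial member lies above such a span, and
    linearity makes spans of different edges incomparable. The size condition keeps these spans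
    different from the bottom. *)
Lemma hypergraph_of_connected_sets E : bridges E -> hconnected E ->
  (forall B, B \in E -> 1 < #|B|) ->
  hypergraph_of (atoms (decomp (connected_sets E))) = E.
Proof.
move=> brE cE E1; have sI := semi_interval_connected_sets brE cE.
set L := decomp _; have botL : \bot%O \in L := decomp_bot sI.
have spanL B : B \in E -> span [set B] \in L.
  by move=> BE; apply: span_decomp => //; rewrite sub1set (subsetP (edges_connected_sets E)).
have span_n0 B : B \in E -> span [set B] != \bot%O.
  move=> /E1/card_gt1P[x [y [xB yB xy]]]; apply: (neq_bot_part xy).
  by rewrite same_block_span; apply: adj_connect xB yB; rewrite inE.
have edge_below P : P \in L -> P != \bot%O -> exists2 B, B \in E & (span [set B] <= P)%O.
  move=> PL Pn; have [S0|/set0Pn[B BS]] := eqVneq (edges_below E P) set0.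
    by case/eqP: Pn; rewrite (decomp_connected_sets PL) S0 span0.
  exists B; first exact: (subsetP (edges_belowS E P)).
  by apply: le_trans (span_edges_below E P); apply: span_mono; rewrite sub1set.
apply/setP => B; apply/hypergraph_ofP/idP => [[P [Pat BP B1]]|BE].
  have [PL Pn minP] := atomsP _ botL Pat; have [C CE CP] := edge_below P PL Pn.
  have {}CP := minP _ (spanL C CE) (span_n0 C CE) CP.
  have [x [y [xB yB xy]]] := card_gt1P B1.
  have [xC _] : x \in C /\ y \in C by apply: span1_block xy; rewrite CP (same_blockE _ BP).
  have Cn0 : C != set0 by apply/set0Pn; exists x.
  have := span1_blocks Cn0; rewrite CP => CbP; have /and3P[_ tiP _] := partP P.
  by rewrite -(def_pblock tiP BP xB) (def_pblock tiP CbP xC).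
exists (span [set B]); split; [|by apply: span1_blocks; rewrite -card_gt0 ltnW ?E1|exact: E1].
apply/atomsP => //; split; [exact: spanL|exact: span_n0|] => Q QL Qn QB.
have [C CE CQ] := edge_below Q QL Qn; apply/le_anti; rewrite QB /=.
have /card_gt1P[x [y [xC yC xy]]] := E1 C CE.
have CB := le_trans CQ QB.
have [xB yB] : x \in B /\ y \in B.
  apply: span1_block xy; apply: (part_leP _ _ CB); rewrite same_block_span.
  by apply: adj_connect xC yC; rewrite inE.
by rewrite (bridges_linear brE BE CE xB yB xC yC xy).
Qed.

End Partitions.

Theorem corollary3p9 (U : finType) (hU : 0 < #|U|) :
  (forall B0 : {set part U},
     boolean_sublattice B0 ->
     (\bot%O \in B0) ->
     (\top%O \in B0) ->
     hypertree (hypergraph_of (atoms B0)) ->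
     exists I : {set {set U}},
       let good (B : {set part U}) :=
         [/\ boolean_sublattice B,
             \bot%O \in B
           & hypergraph_of (atoms B) = hypergraph_of (atoms B0)] in
       [/\ semi_interval_system I,
           good (decomp I)
         & forall B : {set part U}, good B -> decomp I \subset B -> B = decomp I])
  /\
  (forall I : {set {set U}},
     semi_interval_system I ->
     atomistic (decomp I) ->
     (boolean_sublattice (decomp I) <-> hypertree (hypergraph_of (atoms (decomp I))))).
Proof.
split=> [B0 [subB0 _ _] botB0 _ | I sI atI].
  set E := hypergraph_of _; case=> cE acE.
  have brE : bridges E := acyclic_bridges (atoms_linear subB0 botB0) acE.
  have E1 B : B \in E -> 1 < #|B| by case/hypergraph_ofP=> P [].
  have sI := semi_interval_connected_sets brE cE.
  exists (connected_sets E); split=> //.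
    split; [|exact: decomp_bot|exact: hypergraph_of_connected_sets].
    apply: (boolean_decomp sI brE (edges_connected_sets E)).
    exact: decomp_connected_sets.
  (* Maximality: a competitor is generated by its atoms, and their blocks are singletons or edges of
     [E], all of them connected sets. *)
  move=> B [boolB botB HB] DB; apply/eqP; rewrite eqEsubset DB andbT.
  apply: boolean_atoms_generate => //; first exact: decomp_bot.
    apply/subsetP => P Pat; rewrite inE; apply/subsetP => A AP.
    have [A1|A1] := ltnP 1 #|A|.
      apply: (subsetP (edges_connected_sets E)); rewrite -HB.
      by apply/hypergraph_ofP; exists P.
    have [x xA] := block_witness AP.
    rewrite (_ : A = [set x]); first by have [_ [_ sgI] _] := sI.
    by apply/eqP; rewrite eq_sym eqEcard sub1set xA cards1.
  by move=> P Q; apply: decomp_join.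
set E := hypergraph_of _.
have EI : E \subset I := atoms_edges_decomp I.
have linE : linear_hypergraph E.
  by apply: atoms_linear; [exact: decomp_sublattice|exact: decomp_bot].
split=> [[_ dist _] | [_ acE]].
  split; last by move=> c; apply/hcycle_bridge/(distributive_bridges sI).
  apply/hconnectedP => x y.
  (* The top partition belongs to [decomp I], so it is the span of the edges below it, and these
     connect any two points. *)
  apply: (@connect_adjS _ (edges_below E \top%O)); first exact: edges_belowS.
  by rewrite -same_block_span -atomistic_span ?same_block_top //; apply: decomp_top.
apply: (boolean_decomp sI (acyclic_bridges linE acE) EI).
by move=> P; apply: atomistic_span.
Qed.
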